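(* Let $\ell\ge 2$ be an integer and let $\omega$ be the period-doubling sequence. For every $\varepsilon>0$, the limit $\mathrm{DET}_\ell(\omega,\varepsilon)=\lim_{n\to\infty}\mathrm{DET}_\ell(\omega,n,\varepsilon)$ exists and $$\mathrm{DET}_\ell(\omega,\varepsilon)=\frac{\mathrm{RR}_\ell(\omega,\varepsilon)}{\mathrm{RR}_1(\omega,\varepsilon)};$$ and $$\lim_{\varepsilon\to 0}\mathrm{DET}_\ell(\omega,\varepsilon)=1.$$ Moreover, for $\varepsilon>0$, $\mathrm{DET}_\ell(\omega,\varepsilon)=1$ if and only if one of the following three cases happens: (a) $\varepsilon\ge 1$; (b) $2^k\le m_\varepsilon<m_\varepsilon+\ell-1<2^k+2^{k-1}$ for some $k\in\mathbb{N}$; (c) $2^k+2^{k-1}\le m_\varepsilon<m_\varepsilon+\ell-1<2^{k+1}$ for some $k\in\mathbb{N}$.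
   Context: $\mathbb{N}=\{1,2,\dots\}$. The period-doubling sequence $\omega=\omega_1\omega_2\ldots=0100\,0101\,0100\,0100\ldots$ is the unique fixed point in $\{0,1\}^{\mathbb{N}}$ of the substitution $0\mapsto 01$, $1\mapsto 00$; equivalently, $\omega_i=k_i\bmod 2$, where $k_i$ is the largest integer such that $2^{k_i}$ divides $i$. On $\{0,1\}^{\mathbb{N}}$ use the metric $\rho(\alpha,\beta)=0$ if $\alpha=\beta$ and $\rho(\alpha,\beta)=2^{-k+1}$ with $k=\min\{i:\alpha_i\ne\beta_i\}$ if $\alpha\ne\beta$, and the shift $\sigma(\alpha_1\alpha_2\alpha_3\ldots)=\alpha_2\alpha_3\ldots$. For $\ell\ge1$ let $\rho_\ell(\alpha,\beta)=\max_{0\le k<\ell}\rho(\sigma^k(\alpha),\sigma^k(\beta))$ (Bowen's metric), and for $x\in\{0,1\}^{\mathbb{N}}$, $n\in\mathbb{N}$, $\varepsilon>0$ let $\mathrm{C}_\ell(x,n,\varepsilon)=\frac1{n^2}\#\{(i,j):0\le i,j<n,\ \rho_\ell(\sigma^i(x),\sigma^j(x))\le\varepsilon\}$. The recurrence rate and determinism (with minimal required line length $\ell$, embedding dimension $1$) are $\mathrm{RR}_\ell(x,n,\varepsilon)=\ell\cdot \mathrm{C}_\ell(x,n,\varepsilon)-(\ell-1)\cdot \mathrm{C}_{\ell+1}(x,n,\varepsilon)$ and $\mathrm{DET}_\ell(x,n,\varepsilon)=\mathrm{RR}_\ell(x,n,\varepsilon)/\mathrm{RR}_1(x,n,\varepsilon)$;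 $\mathrm{RR}_\ell(x,\varepsilon)$ and $\mathrm{DET}_\ell(x,\varepsilon)$ denote their limits as $n\to\infty$ when these exist. For $\varepsilon>0$: $m_\varepsilon=0$ if $\varepsilon\ge1$; otherwise $m_\varepsilon$ is the unique positive integer with $2^{-m_\varepsilon}\le\varepsilon<2^{-m_\varepsilon+1}$. *)

(* Defs.v *)
From HB Require Import structures.
From mathcomp Require Import all_boot all_order all_algebra.
From mathcomp Require Import all_classical all_reals all_analysis.

Set Implicit Arguments.
Unset Strict Implicit.
Unset Printing Implicit Defensive.

Import Order.TTheory GRing.Theory Num.Theory.
Import numFieldNormedType.Exports.

Local Open Scope classical_set_scope.
Local Open Scope ring_scope.

(* The sequence alpha_1 alpha_2 alpha_3 ... over {0,1} is encoded by
   a : nat -> bool with a i = alpha_(i+1). *)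
Definition binseq := nat -> bool.

Definition shift (a : binseq) : binseq := fun i => a i.+1.

(* 0 |-> 01 and 1 |-> 00, extended to sequences by concatenation; all images of
   letters have length 2. *)
Definition pd_letter (b : bool) : seq bool :=
  if b then [:: false; false] else [:: false; true].

Definition pd_subst (a : binseq) : binseq :=
  fun i => nth false (pd_letter (a i./2)) (odd i).

(* omega_i = (2-adic valuation of i) mod 2, for i >= 1. *)
Definition period_doubling : binseq := fun i => odd (logn 2 i.+1).

Lemma pd_subst_fixed : pd_subst period_doubling =1 period_doubling.
Proof.
move=> i; rewrite /pd_subst /period_doubling /pd_letter.
have [k [b ->]] : exists k (b : bool), i = (b + k.*2)%N.
  by exists i./2, (odd i); rewrite odd_double_half.
rewrite half_bit_double oddD odd_double addbF oddb; case: b => /=.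
  rewrite add1n -doubleS -mul2n lognM // [logn 2 2]logn_prime //=.
  by case: (odd _).
rewrite add0n [logn 2 k.*2.+1]lognE /= dvdn2 /= odd_double.
by case: (odd _).
Qed.

Lemma pd_subst_fixed_unique (a : binseq) :
  pd_subst a =1 a -> a =1 period_doubling.
Proof.
move=> ha i; elim/ltn_ind: i => i IH.
rewrite -ha -pd_subst_fixed /pd_subst.
case: i IH => [|i] IH; first by rewrite /pd_letter; case: (a _); case: (period_doubling _).
by rewrite IH // ltn_half_double -addnn addSn ltnS leq_addl.
Qed.

(* rho(alpha, beta) = 2^(-k+1), k the first index where they differ; in the
   0-based encoding the first difference i is k - 1. *)
Definition rho (R : realType) (a b : binseq) : R :=
  if pselect (exists i, a i != b i) is left h then 2 ^- (ex_minn h) else 0.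

(* rho is nonnegative, so starting the maximum from 0 is harmless. *)
Definition bowen (R : realType) (l : nat) (a b : binseq) : R :=
  \big[Num.max/0]_(k < l) rho R (iter k shift a) (iter k shift b).

Definition corr_sum (R : realType) (l : nat) (x : binseq) (n : nat) (eps : R)
    : R :=
  #|[set ij : 'I_n * 'I_n |
      bowen R l (iter ij.1 shift x) (iter ij.2 shift x) <= eps]%SET|%:R
  / n%:R ^+ 2.

Definition RR (R : realType) (l : nat) (x : binseq) (n : nat) (eps : R) : R :=
  l%:R * corr_sum l x n eps - (l%:R - 1) * corr_sum l.+1 x n eps.

Definition DET (R : realType) (l : nat) (x : binseq) (n : nat) (eps : R) : R :=
  RR l x n eps / RR 1 x n eps.

Definition RR_lim (R : realType) (l : nat) (x : binseq) (eps : R) : R :=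
  limn (fun n => RR l x n eps).

Definition DET_lim (R : realType) (l : nat) (x : binseq) (eps : R) : R :=
  limn (fun n => DET l x n eps).

Definition is_m_eps (R : realType) (eps : R) (m : nat) : Prop :=
  (0 < m)%N /\ 2 ^- m <= eps < 2 ^- m.-1.

(* The default value 0 of xget is only reached for eps <= 0, see m_epsP. *)
Definition m_eps (R : realType) (eps : R) : nat :=
  if 1 <= eps then 0%N else xget 0%N [set m | is_m_eps eps m].

Lemma is_m_eps_unique (R : realType) (eps : R) (m m' : nat) :
  is_m_eps eps m -> is_m_eps eps m' -> m = m'.
Proof.
wlog lt_mm' : m m' / (m < m')%N.
  by move=> H hm hm'; case: (ltngtP m m') => // lt; [|symmetry]; apply: H.
move=> [_ /andP[lem _]] [m'0 /andP[_ ltm']].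
have := le_lt_trans lem ltm'.
rewrite ltf_pV2 ?posrE ?exprn_gt0 // ltr_eXn2l ?ltr1n //.
by rewrite -ltnS prednK // leqNgt ltnS lt_mm'.
Qed.

Lemma m_epsP (R : realType) (eps : R) :
  0 < eps -> eps < 1 -> is_m_eps eps (m_eps eps).
Proof.
move=> e0 e1; rewrite /m_eps leNgt e1 /=.
suff [m hm] : exists m, is_m_eps eps m by exact: (xgetI _ hm).
have ex : exists m, 2 ^- m <= eps.
  exists (Num.bound eps^-1); rewrite -[leRHS]invrK lef_pV2 ?posrE ?invr_gt0 ?exprn_gt0 //.
  apply: le_trans (ltW (archi_boundP _)) _; first by rewrite invr_ge0 ltW.
  by rewrite -natrX ler_nat ltnW // ltn_expl.
case: (ex_minnP ex) => m hm min; exists m.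
have m0 : (0 < m)%N.
  by rewrite lt0n; apply/eqP => m0; move: hm; rewrite m0 expr0 invr1 leNgt e1.
split=> //; rewrite hm /= ltNge; apply/negP => /min.
by rewrite -ltnS prednK // ltnn.
Qed.

(* Main.v *)
Require Import Defs.
From HB Require Import structures.
From mathcomp Require Import all_boot all_order all_algebra.
From mathcomp Require Import all_classical all_reals all_analysis.
From mathcomp Require Import zify ring lra.

Set Implicit Arguments.
Unset Strict Implicit.
Unset Printing Implicit Defensive.

Import Order.TTheory GRing.Theory Num.Theory.
Import numFieldNormedType.Exports.

Local Open Scope classical_set_scope.
Local Open Scope ring_scope.

(** Write [m] for the integer with [2^-m <= eps < 2^-(m-1)].  Two shifts of
    the period-doubling word are [eps]-close for Bowen's metric of order [l]
    exactly when the words of length [m+l-1] read at the two positions are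
    equal, so everything is governed by the limit frequency [c(L)] of pairs of
    positions [(i, j)] at which the same word of length [L] is read
    ([agree_lim]).

    With indices starting at 0, the word satisfies [w(2k) = 0] and
    [w(2k+1) = 1 - w(k)].  Two windows that start at positions of equal parity
    therefore agree exactly when two windows of half the length agree, and
    windows of length at least 3 starting at positions of opposite parity never
    agree, because [11] does not occur in the word.  This gives
      [c(L) = (c(floor(L/2)) + c(ceil(L/2))) / 4]   for [L >= 3]
    ([agree_lim_halve]), with [c(1) = 5/9] and [c(2) = 1/3] coming from the
    density 1/3 of the letter 1.

    Differences behave even better: [d(L) = c(L) - c(L+1)] satisfies
    [d(L) = d(floor(L/2)) / 4] for [L >= 3] ([agree_drop_halve]).  Since
    [d(1) = 2/9], [d(2) = 1/9] and [d(3) = 1/18], the sequence [d] is constant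
    on each of the half-octaves [2^k, 2^k + 2^(k-1)) and
    [2^k + 2^(k-1), 2^(k+1)) with [k >= 1], and is halved from each one to the
    next ([agree_drop_low], [agree_drop_high]).

    Summation by parts turns the limit of [RR_1 - RR_l] into
      [sum_(i < l-1) (d(m+i) - d(m+l-1))]
    ([det_defectE]), a sum of nonnegative terms whose first one is the largest.
    Hence [DET_l = 1] if and only if [d(m) = d(m+l-1)], that is, if [m] and
    [m+l-1] lie in the same half-octave: these are the cases (b) and (c).
    Finally [c(m) >= 1/(2m)] and [d(m) <= 1/(m+1)^2] bound [1 - DET_l] by
    [2(l-1)/(m+1)], which tends to 0 with [eps] ([det_defect_ratio]). *)

Local Notation pd := period_doubling.

(** * Coincidences of words in the period-doubling sequence *)

Lemma pd_double i : pd i.*2 = false.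
Proof.
by rewrite -pd_subst_fixed /pd_subst odd_double doubleK; case: (pd i).
Qed.

Lemma pd_doubleS i : pd i.*2.+1 = ~~ pd i.
Proof.
by rewrite -pd_subst_fixed /pd_subst /= odd_double uphalf_double; case: (pd i).
Qed.

Lemma pd_no11 i : pd i -> pd i.+1 = false.
Proof.
have -> : i = (odd i + i./2.*2)%N by rewrite odd_double_half.
by case: (odd i) => /=; rewrite ?add1n ?add0n -?doubleS pd_double.
Qed.

Definition agree (L i j : nat) : bool :=
  [forall t : 'I_L, pd (i + t)%N == pd (j + t)%N].

Lemma agreeP L i j :
  reflect (forall t, (t < L)%N -> pd (i + t)%N = pd (j + t)%N) (agree L i j).
Proof.
apply: (iffP forallP) => [h t tL|h t]; first exact/eqP/(h (Ordinal tL)).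
exact/eqP/h.
Qed.

Lemma agreeC L i j : agree L i j = agree L j i.
Proof. by apply/agreeP/agreeP => h t tL; rewrite h. Qed.

Lemma agree1 i j : agree 1 i j = (pd i == pd j).
Proof.
by apply/agreeP/eqP => [/(_ 0%N isT)|h [|//] _]; rewrite !addn0.
Qed.

(** The letters at even positions carry no information, and those at odd
    positions spell the complement of the original word; a window of length [L]
    starting at an even position sees [L./2] of the latter. *)
Lemma agree_even L i j : agree L i.*2 j.*2 = agree L./2 i j.
Proof.
apply/agreeP/agreeP => h t tL.
  have /h : (t.*2.+1 < L)%N by lia.
  by rewrite !addnS -!doubleD !pd_doubleS => /negb_inj.
have [k [b et]] : exists k (b : bool), t = (b + k.*2)%N.
  by exists t./2, (odd t); rewrite odd_double_half.
subst t; case: b tL => /= tL.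
  by rewrite add1n !addnS -!doubleD !pd_doubleS h //; lia.
by rewrite add0n -!doubleD !pd_double.
Qed.

(** A window starting at an odd position sees one more odd position when its
    length is odd, whence [uphalf] in place of [L./2]. *)
Lemma agree_odd L i j : agree L i.*2.+1 j.*2.+1 = agree (uphalf L) i j.
Proof.
apply/agreeP/agreeP => h t tL.
  have /h : (t.*2 < L)%N by lia.
  by rewrite !addSn -!doubleD !pd_doubleS => /negb_inj.
have [k [b et]] : exists k (b : bool), t = (b + k.*2)%N.
  by exists t./2, (odd t); rewrite odd_double_half.
subst t; case: b tL => /= tL.
  by rewrite add1n !addSnnS -!doubleS -!doubleD !pd_double.
by rewrite add0n !addSn -!doubleD !pd_doubleS h //; lia.
Qed.

Lemma agree2_even_odd i j : agree 2 i.*2 j.*2.+1 = pd i && pd j.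
Proof.
apply/agreeP/andP => [h|[pi pj]].
  have := h 0%N isT; have := h 1%N isT.
  rewrite !addn1 !addn0 -doubleS !pd_double !pd_doubleS.
  by case: (pd i); case: (pd j).
case=> [|[|//]] _; rewrite ?addn0 ?addn1 -?doubleS !pd_double !pd_doubleS.
  by rewrite pj.
by rewrite pi.
Qed.

(** Opposite parities would align zeros at even positions with two consecutive
    letters at odd positions, hence would require the factor [11]. *)
Lemma agree_even_odd L i j : (3 <= L)%N -> agree L i.*2 j.*2.+1 = false.
Proof.
move=> L3; apply/negP => /agreeP h.
have := h 0%N (ltnW (ltnW L3)); have := h 2%N L3.
rewrite !addn2 !addn0 -!doubleS !pd_double !pd_doubleS.
by case pj: (pd j) => //; rewrite pd_no11.
Qed.

Lemma sum_parity (F : nat -> nat) n :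
  (\sum_(i < n) F i
   = \sum_(i < uphalf n) F i.*2 + \sum_(i < n./2) F i.*2.+1)%N.
Proof.
elim: n => [|n IH]; first by rewrite !big_ord0.
rewrite big_ord_recr /= {}IH uphalf_half.
have en := odd_double_half n.
case: (odd n) en => /= en.
  by rewrite add1n !big_ord_recr /= -[in F n]en add1n; lia.
by rewrite add0n big_ord_recr /= -[in F n]en add0n; lia.
Qed.

Definition agree_count (L n : nat) : nat :=
  (\sum_(i < n) \sum_(j < n) agree L i j)%N.

Definition ones (n : nat) : nat := (\sum_(i < n) pd i)%N.

(** Coincidences between an even and an odd position; by symmetry each such
    pair counts twice in [agree_count]. *)
Definition agree_cross (L n : nat) : nat :=
  (\sum_(i < uphalf n) \sum_(j < n./2) agree L i.*2 j.*2.+1)%N.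

Lemma agree_count_parity L n :
  agree_count L n
  = (agree_count L./2 (uphalf n) + agree_count (uphalf L) n./2
     + (agree_cross L n).*2)%N.
Proof.
rewrite /agree_count (sum_parity (fun i => \sum_(j < n) agree L i j)%N).
under eq_bigr => i _ do rewrite (sum_parity (agree L i.*2)).
under [X in (_ + X)%N]eq_bigr => i _ do rewrite (sum_parity (agree L i.*2.+1)).
rewrite !big_split /=.
under eq_bigr do under eq_bigr do rewrite agree_even.
under [X in (_ + (_ + X))%N]eq_bigr do under eq_bigr do rewrite agree_odd.
under [X in (_ + (X + _))%N]eq_bigr do under eq_bigr do rewrite agreeC.
rewrite [X in (_ + (X + _))%N]exchange_big /=.
by rewrite -/(agree_cross L n); lia.
Qed.

Lemma agree_cross2 n : agree_cross 2 n = (ones (uphalf n) * ones n./2)%N.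
Proof.
rewrite /agree_cross /ones big_distrl /=; apply: eq_bigr => i _.
rewrite big_distrr /=; apply: eq_bigr => j _.
by rewrite agree2_even_odd mulnb.
Qed.

Lemma agree_cross_ge3 L n : (3 <= L)%N -> agree_cross L n = 0%N.
Proof.
move=> L3; apply: big1 => i _; apply: big1 => j _.
by rewrite agree_even_odd.
Qed.

Lemma sum_negb_pd n : (\sum_(i < n) ~~ pd i + ones n = n)%N.
Proof.
rewrite /ones -big_split /= -[RHS]card_ord -sum1_card.
by apply: eq_bigr => i _; case: (pd i).
Qed.

Lemma agree_count1 n : agree_count 1 n = (ones n ^ 2 + (n - ones n) ^ 2)%N.
Proof.
have -> : (n - ones n = \sum_(i < n) ~~ pd i)%N by rewrite -{1}(sum_negb_pd n) addnK.
rewrite -!mulnn /agree_count /ones !big_distrl /= -big_split /=.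
apply: eq_bigr => i _; rewrite !big_distrr -big_split /=.
by apply: eq_bigr => j _; rewrite agree1; case: (pd i); case: (pd j).
Qed.

Lemma ones_half n : (ones n + ones n./2 = n./2)%N.
Proof.
rewrite [in LHS]/ones (sum_parity pd) big1 => [|i _]; last by rewrite pd_double.
by under eq_bigr do rewrite pd_doubleS; rewrite sum_negb_pd.
Qed.

(** Putting [e(n) = 3 ones(n) - n], the relation [ones_half] gives
    [|e(n)| <= 1 + |e(n/2)|], so [e] grows only logarithmically.  The square-root
    bound is weaker but survives one halving step directly:
    [(1 + |s|)^2 <= 3 + 3/2 s^2], and [s^2 <= 6n] at the halved index. *)
Lemma ones_discrepancy n :
  (3 * (ones n)%:Z - n%:Z) ^+ 2 <= 12 * n%:Z.
Proof.
elim/ltn_ind: n => -[_|n IH]; first by rewrite /ones big_ord0.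
have /IH : (n.+1./2 < n.+1)%N by lia.
have := ones_half n.+1.
move: (ones n.+1) (ones n.+1./2) => o o'.
have en := odd_double_half n.+1; move: en.
case: (odd _) => /= en oo' h.
  have -> : o%:Z = n.+1./2%:Z - o'%:Z by lia.
  have e : n.+1%:Z = 2 * n.+1./2%:Z + 1 by lia.
  rewrite !e; move: h; set h' := _%:Z; nia.
have -> : o%:Z = n.+1./2%:Z - o'%:Z by lia.
have e : n.+1%:Z = 2 * n.+1./2%:Z by lia.
rewrite !e; move: h; set h' := _%:Z; nia.
Qed.

(** * Limit frequencies of coincidences *)

(** A discrepancy of order [sqrt n] is negligible against [n].  The hypothesis
    is squared so that no roots are needed when it is applied. *)
Lemma cvg_ratio_of_discrepancy (R : realType) (a : nat -> R) (c K : R) :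
  (forall n, (a n - c * n%:R) ^+ 2 <= K * n%:R) ->
  a n / n%:R @[n --> \oo] --> c.
Proof.
move=> disc; apply/cvgrPdist_le => e e0; near=> n.
have n0 : (0 : R) < n%:R by rewrite ltr0n; near: n; exact: nbhs_infty_ge.
have Kn : K / e ^+ 2 <= n%:R by near: n; exact: nbhs_infty_ger.
rewrite -ler_sqr ?nnegrE ?normr_ge0 ?(ltW e0) // real_normK ?num_real //.
have -> : (c - a n / n%:R) ^+ 2 = (a n - c * n%:R) ^+ 2 / n%:R ^+ 2.
  by field; rewrite gt_eqF.
rewrite ler_pdivrMr ?exprn_gt0 //; apply: le_trans (disc n) _.
rewrite ler_pdivrMr ?exprn_gt0 // in Kn; nra.
Unshelve. all: by end_near. Qed.

Lemma cvg_half_ratio (R : realType) :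
  (n./2)%:R / n%:R @[n --> \oo] --> (2^-1 : R).
Proof.
apply: (@cvg_ratio_of_discrepancy R (fun n => (n./2)%:R) _ 1) => n.
rewrite -{2 3}(odd_double_half n) natrD -mul2n natrM.
have : (0 : R) <= (n./2)%:R by [].
by case: (odd n) => /=; nra.
Qed.

Lemma cvg_uphalf_ratio (R : realType) :
  (uphalf n)%:R / n%:R @[n --> \oo] --> (2^-1 : R).
Proof.
apply: (@cvg_ratio_of_discrepancy R (fun n => (uphalf n)%:R) _ 1) => n.
rewrite uphalf_half -{3 4}(odd_double_half n) !natrD -mul2n natrM.
have : (0 : R) <= (n./2)%:R by [].
by case: (odd n) => /=; nra.
Qed.

Lemma cvg_ones (R : realType) : (ones n)%:R / n%:R @[n --> \oo] --> (3^-1 : R).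
Proof.
apply: (@cvg_ratio_of_discrepancy R (fun n => (ones n)%:R) _ (12 / 9)) => n.
have := ones_discrepancy n; rewrite -(ler_int R) !(rmorphXn, rmorphB, rmorphM) /=.
by rewrite -!pmulrn; lra.
Qed.

Lemma cvg_half_infty : n./2 @[n --> \oo] --> \oo.
Proof.
apply/cvgnyPge => A; near=> n.
by rewrite geq_half_double; near: n; exact: nbhs_infty_ge.
Unshelve. all: by end_near. Qed.

Lemma cvg_uphalf_infty : uphalf n @[n --> \oo] --> \oo.
Proof.
apply/cvgnyPge => A; near=> n.
rewrite geq_uphalf_double leqW //; near: n; exact: nbhs_infty_ge.
Unshelve. all: by end_near. Qed.

(** [f (phi n) / n^p] is [f (phi n) / (phi n)^p] times [(phi n / n)^p].  The
    condition [f 0 = 0] keeps this identity true where [phi n = 0]. *)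
Lemma cvg_rescale (R : realType) (f phi : nat -> nat) (p : nat) (a h : R) :
  f 0 = 0%N -> phi n @[n --> \oo] --> \oo ->
  (phi n)%:R / n%:R @[n --> \oo] --> h ->
  (f n)%:R / n%:R ^+ p @[n --> \oo] --> a ->
  (f (phi n))%:R / n%:R ^+ p @[n --> \oo] --> a * h ^+ p.
Proof.
move=> f0 phioo phih fa.
have -> : (fun n => (f (phi n))%:R / n%:R ^+ p : R)
  = (fun n => (f (phi n))%:R / (phi n)%:R ^+ p * ((phi n)%:R / n%:R) ^+ p).
  apply/funext => n; case: (posnP (phi n)) => [->|phi0].
    by rewrite f0 !mul0r.
  by rewrite expr_div_n mulrA divfK // expf_neq0 // pnatr_eq0 -lt0n.
apply: cvgM; first exact: (cvg_comp phi _ phioo fa).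
exact: (continuous_cvg _ (@exprn_continuous R p h)).
Qed.

Definition agree_freq (R : realType) (L n : nat) : R :=
  (agree_count L n)%:R / n%:R ^+ 2.

Lemma agree_count_at0 L : agree_count L 0 = 0%N.
Proof. by rewrite /agree_count big_ord0. Qed.

Lemma cvg_agree_freq1 (R : realType) :
  agree_freq R 1 n @[n --> \oo] --> (5 / 9 : R).
Proof.
have -> : 5 / 9 = (3^-1 : R) ^+ 2 + (1 - 3^-1) ^+ 2 by field.
have cv : ((ones n)%:R / n%:R : R) ^+ 2 + (1 - (ones n)%:R / n%:R) ^+ 2
   @[n --> \oo] --> (3^-1 : R) ^+ 2 + (1 - 3^-1) ^+ 2.
  apply: cvgD; apply: (continuous_cvg _ (@exprn_continuous R 2 _)).
    exact: cvg_ones.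
  by apply: cvgB; [exact: cvg_cst|exact: cvg_ones].
apply: cvg_trans cv; apply: near_eq_cvg; near=> n.
have n0 : n%:R != 0 :> R.
  by rewrite pnatr_eq0 -lt0n; near: n; exact: nbhs_infty_ge.
rewrite /agree_freq agree_count1 natrD !natrX natrB; last first.
  by rewrite -{2}(sum_negb_pd n) leq_addl.
by field.
Unshelve. all: by end_near. Qed.

Lemma cvg_agree_cross2 (R : realType) :
  (agree_cross 2 n)%:R / n%:R ^+ 2 @[n --> \oo] --> (36^-1 : R).
Proof.
have ones0 : ones 0 = 0%N by rewrite /ones big_ord0.
have c1 : (ones n)%:R / n%:R ^+ 1 @[n --> \oo] --> (3^-1 : R) by exact: cvg_ones.
have cv := cvgM (cvg_rescale ones0 cvg_uphalf_infty (@cvg_uphalf_ratio R) c1)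
                (cvg_rescale ones0 cvg_half_infty (@cvg_half_ratio R) c1).
have -> : (36^-1 : R) = 3^-1 * 2^-1 ^+ 1 * (3^-1 * 2^-1 ^+ 1) by field.
suff -> : (fun n => (agree_cross 2 n)%:R / n%:R ^+ 2 : R)
  = (fun n => (ones (uphalf n))%:R / n%:R ^+ 1 * ((ones n./2)%:R / n%:R ^+ 1)).
  exact: cv.
by apply/funext => n; rewrite agree_cross2 natrM !expr1 expr2 invfM mulrACA.
Qed.

(** Each parity class occupies half of the positions, hence a quarter of the
    pairs: this is the limit form of [agree_count_parity]. *)
Lemma cvg_agree_freq_step (R : realType) (L : nat) (a b x : R) :
  agree_freq R L./2 n @[n --> \oo] --> a ->
  agree_freq R (uphalf L) n @[n --> \oo] --> b ->
  (agree_cross L n)%:R / n%:R ^+ 2 @[n --> \oo] --> x ->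
  agree_freq R L n @[n --> \oo] --> (a + b) / 4 + 2 * x.
Proof.
move=> ca cb cx.
have cv := cvgD (cvgD
    (cvg_rescale (agree_count_at0 _) cvg_uphalf_infty (@cvg_uphalf_ratio R) ca)
    (cvg_rescale (agree_count_at0 _) cvg_half_infty (@cvg_half_ratio R) cb))
  (cvgMl_tmp (a := 2) cx).
have -> : (a + b) / 4 + 2 * x = a * 2^-1 ^+ 2 + b * 2^-1 ^+ 2 + 2 * x by field.
suff -> : agree_freq R L = (fun n =>
    (agree_count L./2 (uphalf n))%:R / n%:R ^+ 2
    + (agree_count (uphalf L) n./2)%:R / n%:R ^+ 2
    + 2 * ((agree_cross L n)%:R / n%:R ^+ 2)) by exact: cv.
apply/funext => n; rewrite /agree_freq agree_count_parity !natrD -mul2n natrM.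
by rewrite !mulrDl mulrA.
Qed.

Lemma cvg_agree_freq2 (R : realType) :
  agree_freq R 2 n @[n --> \oo] --> (3^-1 : R).
Proof.
have -> : (3^-1 : R) = (5 / 9 + 5 / 9) / 4 + 2 * 36^-1 by field.
by apply: cvg_agree_freq_step;
  [exact: cvg_agree_freq1|exact: cvg_agree_freq1|exact: cvg_agree_cross2].
Qed.

Lemma cvg_agree_freq_halve (R : realType) (L : nat) (a b : R) : (3 <= L)%N ->
  agree_freq R L./2 n @[n --> \oo] --> a ->
  agree_freq R (uphalf L) n @[n --> \oo] --> b ->
  agree_freq R L n @[n --> \oo] --> (a + b) / 4.
Proof.
move=> L3 ca cb; rewrite -[_ / 4]addr0 -[X in _ + X](mulr0 2).
apply: cvg_agree_freq_step => //; apply: cvg_near_cst; near=> n.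
by rewrite agree_cross_ge3 // mul0r.
Unshelve. all: by end_near. Qed.

(** The recursion on [L] stops at 1 and 2: in length 1 the halving relation
    refers to length 1 again, and in length 2 windows at positions of opposite
    parity may still agree. *)
Lemma is_cvg_agree_freq (R : realType) (L : nat) : (0 < L)%N ->
  cvgn (agree_freq R L).
Proof.
elim/ltn_ind: L => -[//|[|[|L]]] IH _.
- by apply: cvgP; exact: cvg_agree_freq1.
- by apply: cvgP; exact: cvg_agree_freq2.
- by apply: cvgP; apply: cvg_agree_freq_halve => //; apply: IH; lia.
Qed.

Definition agree_lim (R : realType) (L : nat) : R := limn (agree_freq R L).

Lemma agree_lim1 (R : realType) : agree_lim R 1 = 5 / 9.
Proof. exact/cvg_lim/cvg_agree_freq1. Qed.

Lemma agree_lim2 (R : realType) : agree_lim R 2 = 3^-1.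
Proof. exact/cvg_lim/cvg_agree_freq2. Qed.

Lemma agree_lim_halve (R : realType) (L : nat) : (3 <= L)%N ->
  agree_lim R L = (agree_lim R L./2 + agree_lim R (uphalf L)) / 4.
Proof.
move=> L3; apply/cvg_lim => //.
by apply: cvg_agree_freq_halve => //; apply: is_cvg_agree_freq; lia.
Qed.

(** * The drop from one length to the next *)

Definition agree_drop (R : realType) (L : nat) : R :=
  agree_lim R L - agree_lim R L.+1.

(** For [L = 2k] and for [L = 2k+1] alike, the three frequencies involved in
    the two halving relations reduce to [(c(k) - c(k+1)) / 4]. *)
Lemma agree_drop_halve (R : realType) (L : nat) : (3 <= L)%N ->
  agree_drop R L = agree_drop R L./2 / 4.
Proof.
move=> L3; rewrite /agree_drop (agree_lim_halve R L3) (agree_lim_halve R (leqW L3)).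
rewrite !uphalf_half /= uphalf_half.
by case: (odd L); rewrite ?add1n ?add0n; field.
Qed.

Lemma agree_drop1 (R : realType) : agree_drop R 1 = 2 / 9.
Proof. by rewrite /agree_drop agree_lim1 agree_lim2; field. Qed.

Lemma agree_drop2 (R : realType) : agree_drop R 2 = 1 / 9.
Proof.
by rewrite /agree_drop (@agree_lim_halve R 3) //= agree_lim1 agree_lim2; field.
Qed.

Lemma agree_drop_le (R : realType) (L : nat) : (0 < L)%N ->
  agree_drop R L.+1 <= agree_drop R L.
Proof.
elim/ltn_ind: L => -[//|[|[|L]]] IH _.
- by rewrite agree_drop1 agree_drop2; lra.
- by rewrite (@agree_drop_halve R 3) //= agree_drop1 agree_drop2; lra.
rewrite (@agree_drop_halve R L.+4) // (@agree_drop_halve R L.+3) // ler_pM2r ?invr_gt0 //.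
have [->//|->] : (L.+4./2 = L.+3./2 \/ L.+4./2 = L.+3./2.+1)%N by lia.
by apply: IH; lia.
Qed.

Lemma agree_drop_nonincreasing (R : realType) (L M : nat) :
  (0 < L)%N -> (L <= M)%N -> agree_drop R M <= agree_drop R L.
Proof.
move=> L0 /subnK <-; elim: (M - L)%N => [//|d IH].
by apply: le_trans IH; rewrite addSn agree_drop_le // addn_gt0 L0 orbT.
Qed.

(** Halving sends each half-octave onto the preceding one of the same kind and
    divides the drop by 4, starting from the one-point blocks 2 and 3. *)
Lemma agree_drop_low (R : realType) (k L : nat) :
  (2 ^ k.+1 <= L < 2 ^ k.+1 + 2 ^ k)%N -> agree_drop R L = 4 ^- k / 9.
Proof.
elim: k L => [|k IH] L hL.
  have -> : L = 2%N by move: hL; lia.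
  by rewrite agree_drop2 expr0 invr1.
have := expn_gt0 2 k; rewrite !expnS in hL IH * => k0.
rewrite agree_drop_halve ?IH; [|lia..].
by rewrite exprS; field; rewrite expf_neq0.
Qed.

Lemma agree_drop_high (R : realType) (k L : nat) :
  (2 ^ k.+1 + 2 ^ k <= L < 2 ^ k.+2)%N -> agree_drop R L = 4 ^- k / 18.
Proof.
elim: k L => [|k IH] L hL.
  have -> : L = 3%N by move: hL; lia.
  by rewrite (@agree_drop_halve R 3) //= agree_drop1 expr0 invr1; field.
have := expn_gt0 2 k; rewrite !expnS in hL IH * => k0.
rewrite agree_drop_halve ?IH; [|lia..].
by rewrite exprS; field; rewrite expf_neq0.
Qed.

(** The drop is constant on half-octaves and, being nonincreasing, it never
    recovers a value once it has strictly decreased at the start of a new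
    half-octave. *)
Lemma agree_drop_eq (R : realType) (m M : nat) : (0 < m < M)%N ->
  agree_drop R M = agree_drop R m <->
  (exists k, 2 ^ k.+1 <= m /\ M < 2 ^ k.+1 + 2 ^ k)%N \/
  (exists k, 2 ^ k.+1 + 2 ^ k <= m /\ M < 2 ^ k.+2)%N.
Proof.
move=> /andP[m0 mM]; split; last first.
  by case=> -[k [km Mk]]; [rewrite !(@agree_drop_low _ k)|
    rewrite !(@agree_drop_high _ k)] => //; lia.
move=> eq_drop.
(* [L] is the start of the first half-octave after the one containing [m]. *)
have lt_block L x y : (0 < L)%N -> agree_drop R L = y -> agree_drop R m = x ->
    y < x -> (M < L)%N.
  move=> L0 Ly mx yx; rewrite ltnNge; apply/negP => LM.
  by have := agree_drop_nonincreasing R L0 LM; rewrite eq_drop mx Ly leNgt yx.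
have [m1|m1] := leqP m 1.
  have {m0 m1} m1 : m = 1%N by lia.
  have : (M < 2)%N.
    apply: (lt_block _ (2 / 9) (1 / 9)) => //; last lra.
    - exact: agree_drop2.
    - by rewrite m1 agree_drop1.
  by lia.
have /andP[km mk] := trunc_log_bounds (isT : (1 < 2)%N) m0.
have := trunc_log_max (isT : (1 < 2)%N) (m1 : (2 ^ 1 <= m)%N).
case: (trunc_log 2 m) km mk => // k km mk _.
have k0 := expn_gt0 2 k.
have q0 : (0 : R) < 4 ^- k by rewrite invr_gt0 exprn_gt0.
have [lo|hi] := ltnP m (2 ^ k.+1 + 2 ^ k).
  left; exists k; split => //.
  apply: (lt_block _ (4 ^- k / 9) (4 ^- k / 18)); last by lra.
  - by lia.
  - by apply: agree_drop_high; rewrite leqnn /= [(2 ^ k.+2)%N]expnS expnS; lia.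
  - by apply: agree_drop_low; rewrite km lo.
right; exists k; split => //.
apply: (lt_block _ (4 ^- k / 18) (4 ^- k.+1 / 9)).
- by rewrite expn_gt0.
- by apply: agree_drop_low; rewrite leqnn /= !expnS; lia.
- by apply: agree_drop_high; rewrite hi.
- by rewrite exprS invfM; lra.
Qed.

(** The inequality [2 L c(L) >= 1] passes from [L/2] to [L]: at odd lengths
    [2h+1] this uses [1/h + 1/(h+1) >= 4/(2h+1)]. *)
Lemma agree_lim_ge (R : realType) (L : nat) : (0 < L)%N ->
  1 <= 2 * L%:R * agree_lim R L.
Proof.
elim/ltn_ind: L => -[//|[|[|L]]] IH _.
- by rewrite agree_lim1; lra.
- by rewrite agree_lim2; lra.
move: L.+3 (isT : (3 <= L.+3)%N) IH => M M3 IH.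
have h0 : (0 : R) < (M./2)%:R by rewrite ltr0n; lia.
have eM : M%:R = (odd M)%:R + 2 * (M./2)%:R :> R.
  by rewrite -natrM -natrD mul2n odd_double_half.
have := IH (uphalf M) ltac:(lia) ltac:(lia); have := IH M./2 ltac:(lia) ltac:(lia).
rewrite (agree_lim_halve R M3) eM uphalf_half natrD {IH M3 eM}.
case: (odd M) => /=; last by rewrite !add0r add0n => h _; lra.
move: (agree_lim R _) (agree_lim R _) _%:R h0 => b a h h0 ha hb.
have hh0 : 0 < h * (1 + h) by nra.
rewrite -(ler_pM2l hh0) mulr1.
rewrite [leRHS](_ : _ = (1 + 2 * h) / 4
  * ((1 + h) * (2 * h * a) + h * (2 * (1 + h) * b))); last by field.
have Ha : 1 + h <= (1 + h) * (2 * h * a) by rewrite ler_peMr //; lra.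
have Hb : h <= h * (2 * (1 + h) * b) by rewrite ler_peMr //; lra.
apply: (@le_trans _ _ ((1 + 2 * h) / 4 * (1 + 2 * h))); first by nra.
by rewrite ler_pM2l; lra.
Qed.

Lemma agree_drop_ge0 (R : realType) (L : nat) : (0 < L)%N ->
  0 <= agree_drop R L.
Proof.
elim/ltn_ind: L => -[//|[|[|L]]] IH _.
- by rewrite agree_drop1; lra.
- by rewrite agree_drop2; lra.
by rewrite agree_drop_halve // divr_ge0 // IH //; lia.
Qed.

(** The bound is stable under halving because [L + 1 <= 2 (floor(L/2) + 1)]. *)
Lemma agree_drop_bound (R : realType) (L : nat) : (0 < L)%N ->
  agree_drop R L * (L%:R + 1) ^+ 2 <= 1.
Proof.
elim/ltn_ind: L => -[//|[|[|L]]] IH _.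
- by rewrite agree_drop1; lra.
- by rewrite agree_drop2; lra.
move: L.+3 (isT : (3 <= L.+3)%N) IH => M M3 IH.
have M2 : (0 < M./2)%N by lia.
apply: le_trans (IH M./2 ltac:(lia) M2); rewrite (agree_drop_halve R M3).
rewrite -mulrA ler_wpM2l ?agree_drop_ge0 // ler_pdivrMl //.
rewrite [leRHS](_ : _ = (2 * (M./2%:R + 1)) ^+ 2); last by rewrite exprMn; ring.
rewrite ler_sqr ?nnegrE ?addr_ge0 ?mulr_ge0 ?addr_ge0 //.
rewrite mulrDr mulr1 -natrM !natr1 -natrD ler_nat; lia.
Qed.

(** * The gap between recurrence rates *)

(** The limit of [RR_1 - RR_(p+1)], as [det_defectE] shows, written as a sum
    of nonnegative differences so that its vanishing can be read off. *)
Definition det_defect (R : realType) (p m : nat) : R :=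
  \sum_(i < p) (agree_drop R (m + i) - agree_drop R (m + p)).

Lemma det_defectE (R : realType) (p m : nat) :
  agree_lim R m - (p.+1%:R * agree_lim R (m + p)
                   - p%:R * agree_lim R (m + p).+1) = det_defect R p m.
Proof.
rewrite /det_defect sumrB sumr_const card_ord.
have -> : \sum_(i < p) agree_drop R (m + i) = agree_lim R m - agree_lim R (m + p).
  elim: p => [|p IH]; first by rewrite big_ord0 addn0 subrr.
  by rewrite big_ord_recr IH /agree_drop addnS /= addrA subrK.
by rewrite /agree_drop -mulr_natl -natr1; ring.
Qed.

Lemma det_defect_ge0 (R : realType) (p m : nat) : (0 < m)%N ->
  0 <= det_defect R p m.
Proof.
move=> m0; apply: sumr_ge0 => i _; rewrite subr_ge0.
by apply: agree_drop_nonincreasing; [rewrite addn_gt0 m0|rewrite leq_add2l ltnW].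
Qed.

Lemma det_defect_le (R : realType) (p m : nat) : (0 < m)%N ->
  det_defect R p m <= p%:R * agree_drop R m.
Proof.
move=> m0; rewrite mulr_natl -[X in _ *+ X]card_ord -sumr_const.
apply: ler_sum => i _; apply: le_trans (agree_drop_nonincreasing R m0 (leq_addr i m)).
by rewrite gerBl agree_drop_ge0 // addn_gt0 m0.
Qed.

(** As the drop is nonincreasing, all the terms vanish as soon as the first
    one does. *)
Lemma det_defect_eq0 (R : realType) (p m : nat) : (0 < p)%N -> (0 < m)%N ->
  det_defect R p m = 0 <-> agree_drop R (m + p) = agree_drop R m.
Proof.
move=> p0 m0; have mono i : (i <= p)%N ->
    agree_drop R (m + p) <= agree_drop R (m + i) <= agree_drop R m.
  by move=> ip; rewrite !agree_drop_nonincreasing ?leq_add2l ?leq_addr ?addn_gt0 ?m0.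
split=> [eq0|eq_drop].
  have := @psumr_eq0P R _ xpredT _ _ eq0 (Ordinal p0) isT.
  rewrite /= addn0 => h; apply/esym/subr0_eq/h => i _.
  by rewrite subr_ge0; case/andP: (mono i (ltnW (ltn_ord i))).
apply: big1 => i _; apply/eqP; rewrite subr_eq0 eq_sym eq_le.
by move: (mono i (ltnW (ltn_ord i))); rewrite eq_drop.
Qed.

Lemma det_defect_ratio (R : realType) (p m : nat) : (0 < m)%N ->
  det_defect R p m / agree_lim R m <= 2 * p%:R / (m%:R + 1).
Proof.
move=> m0; have m0' : (0 : R) < m%:R by rewrite ltr0n.
have c1 := agree_lim_ge R m0.
have c0 : 0 < agree_lim R m by nra.
rewrite ler_pdivrMr //; apply: le_trans (det_defect_le R p m0) _.
have m1 : (0 : R) < m%:R + 1 by rewrite ltr_wpDr.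
rewrite [leRHS](_ : _ = p%:R * (2 * agree_lim R m / (m%:R + 1))); last first.
  by field; rewrite gt_eqF.
rewrite ler_wpM2l // ler_pdivlMr // -(ler_pM2r m1) -mulrA -expr2.
apply: le_trans (agree_drop_bound R m0) (le_trans c1 _); lra.
Qed.

(** * From the metric to coincidences of words *)

Lemma iter_shift (x : binseq) (i t : nat) : iter i Defs.shift x t = x (i + t)%N.
Proof. by elim: i t => //= i IH t; rewrite /Defs.shift IH addnS. Qed.

Lemma rho_le (R : realType) (eps : R) (m : nat) (a b : binseq) :
  is_m_eps eps m ->
  rho R a b <= eps <-> (forall t, (t < m)%N -> a t = b t).
Proof.
move=> [m0 /andP[me em]]; rewrite /rho; case: pselect => [h|h]; last first.
  split=> _; last by apply: le_trans me; rewrite invr_ge0 exprn_ge0.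
  by move=> t _; apply: contrapT => ab; apply: h; exists t; exact/eqP.
case: ex_minnP => i ab min; split=> [ie t tm|eq_ab].
  apply: contrapT => /eqP /min it.
  have {em ie} := le_lt_trans ie em.
  by rewrite ltf_pV2 ?posrE ?exprn_gt0 // ltr_eXn2l ?ltr1n //; lia.
apply: le_trans me; rewrite lef_pV2 ?posrE ?exprn_gt0 // ler_eXn2l ?ltr1n //.
by rewrite leqNgt; apply/negP => /eq_ab /eqP; rewrite (negbTE ab).
Qed.

Lemma bowen_le_agree (R : realType) (eps : R) (m p i j : nat) :
  is_m_eps eps m ->
  (bowen R p.+1 (iter i Defs.shift pd) (iter j Defs.shift pd) <= eps) = agree (m + p) i j.
Proof.
move=> me; have [m0 /andP[lem _]] := me.
have e0 : 0 <= eps by apply: le_trans lem; rewrite invr_ge0 exprn_ge0.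
apply/bigmax_leP/agreeP => [[_ h] t tmp|h].
  (* Letter [t] is seen by the earliest of the [p+1] windows of length [m] that
   reaches it. *)
have kp : ((t - m.-1) < p.+1)%N by lia.
  have /(rho_le _ _ me) := h (Ordinal kp) isT.
  have tm : (t - (t - m.-1) < m)%N by lia.
  move=> /(_ _ tm); by rewrite !iter_shift /= subnKC // leq_subr.
split=> // k _; apply/(rho_le _ _ me) => t tm.
by rewrite !iter_shift; apply: h; have := ltn_ord k; lia.
Qed.

Lemma bowen_le1 (R : realType) (l : nat) (a b : binseq) : bowen R l a b <= 1.
Proof.
apply: bigmax_le => // k _; rewrite /rho; case: pselect => // h.
by rewrite invf_le1 ?exprn_gt0 // exprn_ege1 // ler1n.
Qed.

Lemma corr_sum_agree (R : realType) (eps : R) (m p n : nat) :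
  is_m_eps eps m -> corr_sum p.+1 pd n eps = agree_freq R (m + p) n.
Proof.
move=> me; rewrite /corr_sum /agree_freq /agree_count; congr (_%:R / _).
rewrite -sum1_card big_mkcond pair_big /=; apply: eq_bigr => ij _.
by rewrite inE (bowen_le_agree _ _ _ me); case: agree.
Qed.

Lemma corr_sum_ge1 (R : realType) (eps : R) (l n : nat) (x : binseq) :
  1 <= eps -> (0 < n)%N -> corr_sum l x n eps = 1.
Proof.
move=> e1 n0; rewrite /corr_sum (_ : [set _ | _]%SET = [set: 'I_n * 'I_n]%SET);
    last first.
  by apply/setP => ij; rewrite !inE (le_trans (bowen_le1 _ _ _ _) e1).
by rewrite cardsT card_prod card_ord natrM -expr2 divff // expf_neq0 // pnatr_eq0 -lt0n.
Qed.

(** * Recurrence rate and determinism *)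

Lemma cvg_RR_small (R : realType) (eps : R) (m p : nat) : is_m_eps eps m ->
  RR p.+1 pd n eps @[n --> \oo] --> agree_lim R m - det_defect R p m.
Proof.
move=> me; have m0 := me.1; rewrite -det_defectE opprB addrCA subrr addr0.
have -> : (fun n => RR p.+1 pd n eps) =
    (fun n => p.+1%:R * agree_freq R (m + p) n - p%:R * agree_freq R (m + p).+1 n).
  by apply/funext => n; rewrite /RR !(corr_sum_agree _ _ me) addnS -natr1 addrK.
by apply: cvgB; apply: cvgMl_tmp; apply: is_cvg_agree_freq; rewrite // addn_gt0 m0.
Qed.

Lemma cvg_RR_large (R : realType) (eps : R) (l : nat) (x : binseq) : 1 <= eps ->
  RR l x n eps @[n --> \oo] --> (1 : R).
Proof.
move=> e1; apply: cvg_near_cst; near=> n.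
rewrite /RR !corr_sum_ge1 //; try by near: n; exact: nbhs_infty_ge.
by rewrite !mulr1 subKr.
Unshelve. all: by end_near. Qed.

Lemma agree_lim_gt0 (R : realType) (L : nat) : (0 < L)%N -> 0 < agree_lim R L.
Proof.
move=> L0; have := agree_lim_ge R L0; have : (0 : R) < L%:R by rewrite ltr0n.
by nra.
Qed.

(** Determinism is a quotient of recurrence rates, so its limit follows from
    theirs; the limit values are recorded because [RR_lim] and [DET_lim] are
    total operators that carry no proof of convergence. *)
Lemma det_limits (R : realType) (eps : R) (l : nat) (x : binseq) (r s : R) :
  RR l x n eps @[n --> \oo] --> r -> RR 1 x n eps @[n --> \oo] --> s ->
  s != 0 ->
  [/\ DET l x n eps @[n --> \oo] --> r / s,
      RR_lim l x eps = r, RR_lim 1 x eps = s & DET_lim l x eps = r / s].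
Proof.
move=> cr cs s0.
have cd : DET l x n eps @[n --> \oo] --> r / s by apply: cvgM => //; exact: cvgV.
by split=> //; exact/cvg_lim.
Qed.

Lemma cvg_RR1_small (R : realType) (eps : R) (m : nat) : is_m_eps eps m ->
  RR 1 pd n eps @[n --> \oo] --> agree_lim R m.
Proof.
move=> me; have := @cvg_RR_small R eps m 0 me.
by rewrite /det_defect big_ord0 subr0.
Qed.

Lemma DET_lim_small (R : realType) (eps : R) (m p : nat) : is_m_eps eps m ->
  DET_lim p.+1 pd eps = 1 - det_defect R p m / agree_lim R m.
Proof.
move=> me; have c0 := lt0r_neq0 (agree_lim_gt0 R me.1).
have [_ _ _ ->] := det_limits (cvg_RR_small (p := p) me) (cvg_RR1_small me) c0.
by rewrite mulrBl divff.
Qed.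

Lemma DET_lim_large (R : realType) (eps : R) (l : nat) (x : binseq) :
  1 <= eps -> DET_lim l x eps = 1.
Proof.
move=> e1; have c0 : (1 : R) != 0 by [].
have [_ _ _ ->] := det_limits (@cvg_RR_large R eps l x e1)
  (@cvg_RR_large R eps 1 x e1) c0.
by rewrite divr1.
Qed.

Lemma is_m_eps_lt (R : realType) (eps : R) (m M : nat) :
  is_m_eps eps m -> eps < 2 ^- M -> (M < m)%N.
Proof.
move=> [_ /andP[me _]] eM; have := le_lt_trans me eM.
by rewrite ltf_pV2 ?posrE ?exprn_gt0 // ltr_eXn2l ?ltr1n.
Qed.

Theorem theorem1p6 (R : realType) (l : nat) (hl : (2 <= l)%N) :
  [/\ (forall eps : R, 0 < eps ->
         [/\ cvgn (fun n => DET l period_doubling n eps),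
             cvgn (fun n => RR l period_doubling n eps),
             cvgn (fun n => RR 1 period_doubling n eps),
             RR_lim 1 period_doubling eps != 0 &
             DET_lim l period_doubling eps
             = RR_lim l period_doubling eps / RR_lim 1 period_doubling eps]),
      (DET_lim l period_doubling eps @[eps --> (0 : R)^'+] --> (1 : R)) &
      (forall eps : R, 0 < eps ->
         (DET_lim l period_doubling eps = 1 <->
          [\/ 1 <= eps,
              (exists k : nat, (0 < k)%N /\
                 (2 ^ k <= m_eps eps /\
                  m_eps eps < m_eps eps + l - 1 < 2 ^ k + 2 ^ (k - 1))%N) |
              (exists k : nat, (0 < k)%N /\
                 (2 ^ k + 2 ^ (k - 1) <= m_eps eps /\
                  m_eps eps < m_eps eps + l - 1 < 2 ^ k.+1)%N)]))].
Proof.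
case: l hl => [//|p]; rewrite ltnS => p0; split.
- move=> eps e0.
  have [r [s [cr cs s0]]] : exists r s : R,
      [/\ RR p.+1 pd n eps @[n --> \oo] --> r,
          RR 1 pd n eps @[n --> \oo] --> s & s != 0].
    have [e1|e1] := leP 1 eps.
      by exists 1, 1; split; [exact: cvg_RR_large|exact: cvg_RR_large|].
    have me := m_epsP e0 e1.
    exists (agree_lim R (m_eps eps) - det_defect R p (m_eps eps)).
    exists (agree_lim R (m_eps eps)); split; first exact: cvg_RR_small.
      exact: cvg_RR1_small.
    exact: lt0r_neq0 (agree_lim_gt0 R me.1).
  have [cd -> -> ->] := det_limits cr cs s0.
  by split=> //; [exact: cvgP cd|exact: cvgP cr|exact: cvgP cs].
- apply/cvgrPdist_le => e e0.
  have e2 : 0 <= 2 * p%:R / e by rewrite divr_ge0 // ltW.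
  (* [eps < 2^-M] forces [m > M], and [M] exceeds [2p/e]. *)
  pose M := Num.bound (2 * p%:R / e).
  near=> eps.
  have eps0 : 0 < eps by near: eps; exact: nbhs_right_gt.
  have epsM : eps < 2 ^- M.
    by near: eps; apply: nbhs_right_lt; rewrite invr_gt0 exprn_gt0.
  have eps1 : eps < 1.
    by apply: lt_le_trans epsM _; rewrite invf_le1 ?exprn_gt0 // exprn_ege1 // ler1n.
  have me := m_epsP eps0 eps1; have Mm := is_m_eps_lt me epsM.
  rewrite (DET_lim_small p me) subKr ger0_norm; last first.
    by rewrite divr_ge0 ?det_defect_ge0 ?(ltW (agree_lim_gt0 R me.1)) // me.1.
  apply: le_trans (det_defect_ratio R p me.1) _.
  rewrite ler_pdivrMr // [leRHS]mulrC -ler_pdivrMr //; apply: ltW.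
  apply: lt_trans (archi_boundP e2) _; rewrite natr1 ltr_nat; exact: ltnW.
move=> eps e0; have [e1|e1] := leP 1 eps.
  by split=> _; [exact: Or31|exact: DET_lim_large].
have me := m_epsP e0 e1; move: (m_eps eps) me => m me.
have c0 := lt0r_neq0 (agree_lim_gt0 R me.1).
rewrite (DET_lim_small p me) addnS subn1 /=.
have -> : 1 - det_defect R p m / agree_lim R m = 1 <-> det_defect R p m = 0.
  split=> [/eqP|->]; last by rewrite mul0r subr0.
  rewrite -subr_eq0 addrAC subrr add0r oppr_eq0 mulf_eq0 invr_eq0 (negbTE c0) orbF.
  by move/eqP.
have mp : (0 < m < m + p)%N by rewrite me.1 /= -[ltnLHS]addn0 ltn_add2l.
rewrite (det_defect_eq0 R p0 me.1) (agree_drop_eq R mp); case/andP: mp => _ mp.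
split=> [[[k [km mk]]|[k [km mk]]]|].
- by apply: Or32; exists k.+1; rewrite subn1 mp.
- by apply: Or33; exists k.+1; rewrite subn1 mp.
case=> [//|[[|k] [//_ ]]|[[|k] [//_ ]]]; rewrite subn1 mp /= => -[km mk].
  by left; exists k.
by right; exists k.
Unshelve. all: by end_near. Qed.
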